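(* Let $\alpha\in(0,1)$ be irrational and let $\varphi\in\mathcal C$ be such that there exist $M,\eta,\theta>0$ with $\mathrm{Card}\{1\le j\le N:\ a_{j+1}\,|\gamma_{q_j}(\varphi)|\ge\eta\}\ge\theta N$ for all $N\ge M$. Then there are positive constants $\eta_0,c$ (depending on $\alpha$ and $\varphi$) such that the set $$W:=\Big\{n\in\mathbb N:\ m(n)\ge2,\ \|\varphi_n\|_2\ge\eta_0\Big(\frac{m(n)}{\ln m(n)}\Big)^{1/2}\Big\}$$ satisfies, for every $N\ge1$ with $m(N)\ge2$, $$\frac{\mathrm{Card}(W\cap[0,N[)}{N}\ \ge\ 1-2c\,(\ln m(N))^{-1/2}.$$
   Context: $\alpha=[0;a_1,a_2,\dots]$ has partial quotients $a_n$ and denominators $q_n$: $q_0=1$, $q_1=a_1$, $q_{n+1}=a_{n+1}q_n+q_{n-1}$. For $n\ge1$, $m(n)$ is the integer such that $q_{m(n)}\le n<q_{m(n)+1}$. $\mu$ is Lebesgue measure on $\mathbb T^1=\mathbb R/\mathbb Z$, $\|\cdot\|_2$ the $L^2(\mu)$ norm. $\mathcal C$ is the class of real-valued functions of bounded variation on $\mathbb T^1$ with $\int\varphi\,d\mu=0$; $\gamma_r(\varphi):=r\,\hat\varphi(r)$ for $r\neq0$, where $\hat\varphi(r)$ are the Fourier coefficients; $\varphi_n(x)=\sum_{j=0}^{n-1}\varphi(x+j\alpha)$. *)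

(* Defs.v *)
From HB Require Import structures.
From mathcomp Require Import all_boot all_order all_algebra.
From mathcomp Require Import finmap.
From mathcomp Require Import complex.
From mathcomp Require Import all_classical all_reals all_analysis.

Set Implicit Arguments.
Unset Strict Implicit.
Unset Printing Implicit Defensive.

Import Order.TTheory GRing.Theory Num.Theory.
Import numFieldNormedType.Exports.

Local Open Scope classical_set_scope.
Local Open Scope ring_scope.

Section ContinuedFraction.
Variable R : realType.
Implicit Types (alpha x : R) (n : nat).

Definition gauss_map x : R := x^-1 - (Num.floor x^-1)%:~R.

(* a_{n+1} is the integer part of 1 / G^n(alpha), G being the Gauss map; the
   value 0 at n = 0 is the integer part of alpha when 0 < alpha < 1. *)
Definition partial_quotient alpha n : nat :=
  if n is k.+1 then Num.truncn (iter k gauss_map alpha)^-1 else 0%N.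

Fixpoint cf_denominator alpha n : nat :=
  match n with
  | 0%N => 1%N
  | k.+1 => match k with
            | 0%N => partial_quotient alpha 1
            | l.+1 => (partial_quotient alpha k.+1 * cf_denominator alpha k
                       + cf_denominator alpha l)%N
            end
  end.

(* For n >= 1 and irrational alpha the set below is a singleton; it is empty
   for n = 0, where the value is the default 0. *)
Definition cf_index alpha n : nat :=
  xget 0%N [set m : nat |
    (cf_denominator alpha m <= n < cf_denominator alpha m.+1)%N].

End ContinuedFraction.

(* Functions on the circle R/Z are 1-periodic functions on R, integrated over
   the fundamental domain [0, 1]. *)
Section Circle.
Variable R : realType.
Implicit Types (f phi : R -> R) (alpha x : R).

Local Notation mu := (@lebesgue_measure R).

Definition circle_BV0 phi : Prop :=
  [/\ periodic phi 1, bounded_variation 0 1 phi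
    & (\int[mu]_(x in `[0, 1]) phi x)%R = 0].

Definition L2norm f : \bar R := Lnorm mu 2%:E ((EFin \o f) \_ `[0, 1]).

Definition cexpi (t : R) : R[i] := (cos t +i* sin t)%C.

Definition circle_integralC (F : R -> R[i]) : R[i] :=
  ((\int[mu]_(x in `[0, 1]) complex.Re (F x))%R
   +i* (\int[mu]_(x in `[0, 1]) complex.Im (F x))%R)%C.

Definition fourier_coef phi (r : int) : R[i] :=
  circle_integralC
    (fun x => (phi x)%:C%C * cexpi (- (2 * pi * r%:~R * x))).

Definition gamma_coef phi (r : int) : R[i] := r%:~R * fourier_coef phi r.

Definition ergodic_sum phi alpha (n : nat) : R -> R :=
  fun x => \sum_(0 <= j < n) phi (x + j%:R * alpha).

End Circle.

(* Main.v *)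
Require Import Defs.
From HB Require Import structures.
From mathcomp Require Import all_boot all_order all_algebra.
From mathcomp Require Import finmap.
From mathcomp Require Import complex.
From mathcomp Require Import all_classical all_reals all_analysis.
From mathcomp Require Import measurable_realfun lra ring zify.

(* Put d_j = ||q_j alpha||.  Passing from phi to phi_n multiplies the
   coefficient of order q_j by a Dirichlet kernel, so that
   |c_{q_j}(phi_n)|^2 (1 - cos 2 pi d_j) = |c_{q_j}(phi)|^2 (1 - cos 2 pi n d_j).
   As a_{j+1} q_j d_j <= 1, every resonant j (one with
   a_{j+1} |gamma_{q_j}| >= eta) such that 1 - cos (2 pi n d_j) >= eps^2
   contributes at least eta^2 eps^2 / 32 to Bessel's lower bound for ||phi_n||_2^2.
   Since n |-> n d_j turns around the circle with step d_j of order 1 / q_{j+1},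
   the inequality 1 - cos (2 pi n d_j) < eps^2 holds for at most
   20 eps N + 3 N / q_{j+1} integers n < N when q_{j+1} <= N.  Summing over
   j < m = m(N), with sum_j 1 / q_j <= 4, Markov's inequality shows that for all
   n < N outside a proportion O(eps) at least theta (m - 1) / 2 resonant j < m
   contribute; the choice eps = (ln m)^(-1/2) gives the theorem. *)

Import Order.TTheory GRing.Theory Num.Theory.
Import numFieldNormedType.Exports.

Local Open Scope classical_set_scope.
Local Open Scope ring_scope.

Set Implicit Arguments.
Unset Strict Implicit.

(** * Integration on the circle *)

Section CircleIntegral.
Variable R : realType.
Implicit Types (f g F : R -> R) (a b u v x : R).
Local Notation mu := (@lebesgue_measure R).

Definition translation a : measurableTypeR R -> measurableTypeR R := fun x => x + a.

Lemma measurable_translation a : measurable_fun setT (translation a).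
Proof. by apply: measurable_funD => //; exact: measurable_cst. Qed.

HB.instance Definition _ a :=
  isMeasurableFun.Build _ _ _ _ (translation a) (measurable_translation a).

(** The pushforward gives each interval ]u, v] its length, and Lebesgue measure is the only measure
    that does. *)
Lemma lebesgue_measureD a (A : set R) : measurable A ->
  pushforward mu (translation a) A = mu A.
Proof.
move=> mA; apply/esym/lebesgue_measure_unique => //= _ [[u v]] _ <-.
rewrite /pushforward.
have -> : translation a @^-1` `]u, v]%classic = `]u - a, v - a]%classic.
  by apply/seteqP; split => x /=; rewrite /translation !in_itv /=; lra.
rewrite !lebesgue_measure_itv/= !lte_fin ltrD2r.
by case: ifP => // _; rewrite -!EFinB; congr EFin; ring.
Qed.

(** A class stable under sums, products and translations whose members are integrable on bounded
    intervals; the integrability side conditions below reduce to it. *)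
Definition bounded_measurable f :=
  measurable_fun setT f /\ exists M : R, forall x, `|f x| <= M.

Lemma bounded_measurable_cst a : bounded_measurable (fun=> a).
Proof. by split; [exact: measurable_cst | exists `|a|]. Qed.

Lemma bounded_measurableD f g : bounded_measurable f -> bounded_measurable g ->
  bounded_measurable (fun x => f x + g x).
Proof.
move=> [mf [M fM]] [mg [K gK]]; split; first exact: measurable_funD.
by exists (M + K) => x; rewrite (le_trans (ler_normD _ _))// lerD.
Qed.

Lemma bounded_measurableM f g : bounded_measurable f -> bounded_measurable g ->
  bounded_measurable (fun x => f x * g x).
Proof.
move=> [mf [M fM]] [mg [K gK]]; split; first exact: measurable_funM.
by exists (M * K) => x; rewrite normrM ler_pM.
Qed.

Lemma bounded_measurable_sum I (s : seq I) (P : pred I) (F : I -> R -> R) :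
  (forall i, P i -> bounded_measurable (F i)) ->
  bounded_measurable (fun x => \sum_(i <- s | P i) F i x).
Proof.
move=> bF; elim: s => [|i s IH].
  by under eq_fun do rewrite big_nil; exact: bounded_measurable_cst.
under eq_fun do rewrite big_cons; case: (boolP (P i)) => Pi //.
by apply: bounded_measurableD => //; exact: bF.
Qed.

Lemma bounded_measurable_translate a f : bounded_measurable f ->
  bounded_measurable (fun x => f (x + a)).
Proof.
move=> [mf [M fM]]; split; last by exists M => x.
apply: (measurableT_comp mf).
by apply: measurable_funD => //; exact: measurable_cst.
Qed.

Lemma bounded_measurable_integrable f u v (b c : bool) : bounded_measurable f ->
  mu.-integrable [set` Interval (BSide b u) (BSide c v)] (EFin \o f).
Proof.
move=> [mf [M fM]]; apply: measurable_bounded_integrable => //.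
- by rewrite /= lebesgue_measure_itv; case: ifP => //= _; rewrite -EFinB ltry.
- exact: measurable_funTS.
- exists M; split; first by rewrite num_real.
  by move=> y My x _; exact: le_trans (fM x) (ltW My).
Qed.

Lemma Rintegral_translate a f u v : bounded_measurable f ->
  \int[mu]_(x in `[u, v[) f (x + a) = \int[mu]_(x in `[u + a, v + a[) f x.
Proof.
move=> bf.
have E : translation a @^-1` `[u + a, v + a[ = `[u, v[%classic.
  by apply/seteqP; split => x /=; rewrite /translation !in_itv /=; lra.
rewrite /Rintegral; congr fine.
rewrite -[LHS]/(\int[mu]_(x in `[u, v[) ((EFin \o f) \o translation a) x)%E.
rewrite -E -integral_pushforward //.
- by apply: eq_measure_integral => A mA _; exact: lebesgue_measureD.
- by apply/measurable_EFinP; case: bf.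
- by rewrite E; exact: (bounded_measurable_integrable _ _ _ _ (bounded_measurable_translate a bf)).
Qed.

Lemma periodicz f : periodic f 1 -> forall (k : int) x, f (x + k%:~R) = f x.
Proof.
move=> pf [n|n] x; first by rewrite -(periodicn pf n x) -pmulrn.
by rewrite NegzE mulrNz -(periodicn pf n.+1 (x - _)) -pmulrn subrK.
Qed.

Lemma Rintegral_split f u v w : bounded_measurable f -> u <= v -> v <= w ->
  \int[mu]_(x in `[u, w[) f x =
  \int[mu]_(x in `[u, v[) f x + \int[mu]_(x in `[v, w[) f x.
Proof.
move=> bf uv vw.
have E : `[u, w[%classic = `[u, v[%classic `|` `[v, w[%classic.
  by rewrite -itv_bndbnd_setU // bnd_simp.
rewrite {1}E Rintegral_setU //.
  by rewrite -E; exact: bounded_measurable_integrable.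
apply/disj_setPS => x [/=]; rewrite !in_itv/= => /andP[_ xv] /andP[vx _].
by have := le_lt_trans vx xv; rewrite ltxx.
Qed.

Local Notation I f := (\int[mu]_(x in `[0, 1]) f x).

Lemma circle_integral_bndo f : bounded_measurable f ->
  I f = \int[mu]_(x in `[0, 1[) f x.
Proof.
by move=> bf; rewrite Rintegral_itv_bndo_bndc //; exact: bounded_measurable_integrable.
Qed.

Lemma circle_integral_translate a f : bounded_measurable f -> periodic f 1 ->
  \int[mu]_(x in `[0, 1]) f (x + a) = \int[mu]_(x in `[0, 1]) f x.
Proof.
move=> bf pf.
(* By periodicity only the fractional part b of a matters. The integral over [b, 1 + b[ is then cut
   at 1, and the piece [1, 1 + b[ is moved back to [0, b[. *)
pose b := a - (Num.floor a)%:~R.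
have [b0 b1] : 0 <= b /\ b <= 1.
  by have := floor_le a; have := floorD1_gt a; rewrite /b intrD1 => ? ?; lra.
have -> : (fun x => f (x + a)) = (fun x => f (x + b)).
  apply/funext => x; rewrite -(periodicz pf (Num.floor a) (x + b)).
  by congr f; rewrite /b; ring.
rewrite !circle_integral_bndo//; last exact: bounded_measurable_translate.
rewrite Rintegral_translate// add0r.
rewrite (@Rintegral_split _ b 1) //; last lra.
rewrite [in RHS](@Rintegral_split _ 0 b)// addrC; congr (_ + _).
under [in RHS]eq_Rintegral do rewrite -pf.
by rewrite Rintegral_translate // add0r addrC.
Qed.

Lemma circle_integralD f g : bounded_measurable f -> bounded_measurable g ->
  I (fun x => f x + g x) = I f + I g.
Proof. by move=> bf bg; rewrite RintegralD//; exact: bounded_measurable_integrable. Qed.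

Lemma circle_integralZ a f : bounded_measurable f ->
  I (fun x => a * f x) = a * I f.
Proof. by move=> bf; rewrite RintegralZl//; exact: bounded_measurable_integrable. Qed.

Lemma circle_integral_sum J (s : seq J) (P : pred J) (F : J -> R -> R) :
  (forall i, P i -> bounded_measurable (F i)) ->
  I (fun x => \sum_(i <- s | P i) F i x) = \sum_(i <- s | P i) I (F i).
Proof.
move=> bF; elim: s => [|i s IH].
  by rewrite big_nil; under eq_Rintegral do rewrite big_nil; rewrite Rintegral_cst ?mul0r.
rewrite big_cons; under eq_Rintegral do rewrite big_cons.
case: (boolP (P i)) => Pi //.
rewrite circle_integralD ?IH//; first exact: bF.
exact: bounded_measurable_sum.
Qed.

Lemma le_circle_integral f g : bounded_measurable f -> bounded_measurable g ->
  (forall x, f x <= g x) -> I f <= I g.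
Proof.
by move=> bf bg fg; apply: le_Rintegral => //; exact: bounded_measurable_integrable.
Qed.

(** Jordan decomposition: on [0, 1], f is a difference of two monotone functions, up to a constant
    contained in them; periodicity extends this to the line through the fractional part. *)
Lemma circle_BV_bounded_measurable f :
  periodic f 1 -> bounded_variation 0 1 f -> bounded_measurable f.
Proof.
move=> pf bv.
(* The variation functions are controlled on [0, 1] only; composing with this clamp makes them
   monotone and bounded on the whole line. *)
pose cl x := Num.max 0 (Num.min x 1) : R.
have clitv x : cl x \in `[0, 1].
  by rewrite in_itv /= /cl le_max lexx ge_max ler01 ge_min lexx orbT.
have clnd : nondecreasing_fun cl.
  move=> x y xy; rewrite /cl ge_max !le_max lexx /= le_min !ge_min lexx xy.
  by rewrite !orbT.
have mono g : bounded_variation 0 1 g ->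
    bounded_measurable (fun x => (fine \o neg_tv 0 g) (cl x)).
  move=> bg.
  have nd x y : cl x <= cl y -> (fine \o neg_tv 0 g) (cl x) <= (fine \o neg_tv 0 g) (cl y).
    exact: (fine_neg_tv_nondecreasing bg).
  split; first by apply: nondecreasing_measurable => // x y xy; apply: nd; exact: clnd.
  exists (`|(fine \o neg_tv 0 g) (cl 0)| + `|(fine \o neg_tv 0 g) (cl 1)|) => x.
  have [c0 c1] : cl 0 <= cl x /\ cl x <= cl 1.
    have := clitv x; rewrite in_itv /= => /andP[? ?].
    by rewrite {1 4}/cl minxx (min_l ler01) maxxx (max_r ler01).
  have := nd _ _ c0; have := nd _ _ c1; set A := _ (cl x); set B := _ (cl 0).
  set C := _ (cl 1) => AC BA; rewrite ler_norml.
  have := ler_norm C; have := ler_norm (- B); rewrite normrN.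
  by have := normr_ge0 B; have := normr_ge0 C; lra.
pose fr x := x - (Num.floor x)%:~R : R.
have mfr : measurable_fun setT fr.
  apply: measurable_funB => //; apply: nondecreasing_measurable => // x y xy.
  by rewrite ler_int le_floor.
have frP x : 0 <= fr x /\ fr x <= 1.
  by have := floor_le x; have := floorD1_gt x; rewrite /fr intrD1 => ? ?; lra.
have clfr x : cl (fr x) = fr x.
  by have [? ?] := frP x; rewrite /cl min_l// max_r.
have -> : f = (fun x => (fine \o neg_tv 0 (\- f)) (cl (fr x)) + (-1) * (fine \o neg_tv 0 f) (cl (fr x))).
  apply/funext => x; rewrite !clfr.
  rewrite -{1}(subrK (Num.floor x)%:~R x) periodicz // -/(fr x).
  rewrite (bounded_variation_pos_neg_tvE bv) /=; first by rewrite mulN1r.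
  by rewrite in_itv/=; have [-> ->] := frP x.
have comp g : bounded_measurable g -> bounded_measurable (fun x => g (fr x)).
  by move=> [mg [K gK]]; split; [exact: measurableT_comp | exists K].
apply: bounded_measurableD.
  by apply: (comp (fun x => (fine \o neg_tv 0 (\- f)) (cl x))); apply: mono; exact: bounded_variationN.
apply: bounded_measurableM; first exact: bounded_measurable_cst.
by apply: (comp (fun x => (fine \o neg_tv 0 f) (cl x))); exact: mono.
Qed.

End CircleIntegral.

(** * Fourier coefficients of ergodic sums *)

Section Trigonometric.
Variable R : realType.
Implicit Types (f phi : R -> R) (a b t x alpha : R) (r s k n : nat).
Local Notation mu := (@lebesgue_measure R).
Local Notation I f := (\int[mu]_(x in `[0, 1]) f x).

(** With both coefficients free, the family of a given frequency is stable under translation, and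
    products are sums of two members. *)
Definition trig r a b x : R :=
  a * cos (2 * pi * r%:R * x) + b * sin (2 * pi * r%:R * x).

Lemma trig10 r : trig r 1 0 = (fun x => cos (2 * pi * r%:R * x)).
Proof. by apply/funext => x; rewrite /trig mul1r mul0r addr0. Qed.

Lemma trig01 r : trig r 0 1 = (fun x => sin (2 * pi * r%:R * x)).
Proof. by apply/funext => x; rewrite /trig mul1r mul0r add0r. Qed.

Lemma cosD2pin n t : cos (t + 2 * pi * n%:R) = cos t.
Proof.
rewrite -(periodicn (@cosD2pi R) n t); congr (cos (t + _)).
by rewrite -mulr_natr -mulr_natl; ring.
Qed.

Lemma sinD2pin n t : sin (t + 2 * pi * n%:R) = sin t.
Proof.
rewrite -(periodicn (@sinD2pi R) n t); congr (sin (t + _)).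
by rewrite -mulr_natr -mulr_natl; ring.
Qed.

Lemma periodic_trig r a b : periodic (trig r a b) 1.
Proof. by move=> x; rewrite /trig mulrDr mulr1 cosD2pin sinD2pin. Qed.

Lemma bounded_measurable_trig r a b : bounded_measurable (trig r a b).
Proof.
have mlin : measurable_fun setT (fun x : R => 2 * pi * r%:R * x).
  by apply: measurable_funM => //; exact: measurable_cst.
apply: bounded_measurableD; apply: bounded_measurableM;
  try exact: bounded_measurable_cst.
- split; last by exists 1 => x; exact: cos_max.
  apply: measurableT_comp mlin; apply: continuous_measurable_fun.
  exact: continuous_cos.
- split; last by exists 1 => x; exact: sin_max.
  apply: measurableT_comp mlin; apply: continuous_measurable_fun.
  exact: continuous_sin.
Qed.

(* For k > 0 the translation by half a period changes the sign of the integrand. *)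
Lemma circle_integral_trig k a b : I (trig k a b) = a * (k == 0%N)%:R.
Proof.
have [->|k0] := eqVneq k 0%N.
  have -> : trig 0 a b = cst a.
    by apply/funext => x; rewrite /trig mulr0 mul0r cos0 sin0 /cst; ring.
  by rewrite Rintegral_cst// /= lebesgue_measure_itv/= lte_fin ltr01 /= subr0.
rewrite mulr0; have := circle_integral_translate (2 * k%:R)^-1
  (bounded_measurable_trig k a b) (periodic_trig k a b).
have -> : (fun x => trig k a b (x + (2 * k%:R)^-1)) = (fun x => (-1) * trig k a b x).
  apply/funext => x; rewrite /trig.
  have -> : 2 * pi * k%:R * (x + (2 * k%:R)^-1) = 2 * pi * k%:R * x + pi :> R.
    by field; rewrite pnatr_eq0.
  by rewrite cosDpi sinDpi; ring.
by rewrite circle_integralZ; [lra | exact: bounded_measurable_trig].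
Qed.

Lemma trigM r s a b a' b' x : (r <= s)%N ->
  trig r a b x * trig s a' b' x =
  trig (s - r) ((a * a' + b * b') / 2) ((a * b' - b * a') / 2) x +
  trig (s + r) ((a * a' - b * b') / 2) ((a * b' + b * a') / 2) x.
Proof.
move=> rs; rewrite /trig natrB// natrD.
have -> : 2 * pi * (s%:R - r%:R) * x = 2 * pi * s%:R * x - 2 * pi * r%:R * x by ring.
have -> : 2 * pi * (s%:R + r%:R) * x = 2 * pi * s%:R * x + 2 * pi * r%:R * x by ring.
by rewrite cosB sinB cosD sinD; field.
Qed.

(** By symmetry r <= s, so that the natural subtraction in [trigM] is exact. The term of frequency s
    + r > 0 has mean zero, and so has the other one unless s = r. *)
Lemma circle_integral_trigM r s a b a' b' : (0 < r)%N -> (0 < s)%N ->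
  I (fun x => trig r a b x * trig s a' b' x) =
  (a * a' + b * b') / 2 * (r == s)%:R.
Proof.
wlog rs : r s a b a' b' / (r <= s)%N => [hw|] r0 s0.
  have [/hw->//|/ltnW/hw h] := leqP r s.
  under eq_Rintegral do rewrite mulrC.
  by rewrite h// eq_sym; ring.
under eq_Rintegral do rewrite trigM//.
rewrite circle_integralD; try exact: bounded_measurable_trig.
rewrite !circle_integral_trig addn_eq0 (gtn_eqF r0) andbF mulr0 addr0.
by rewrite subn_eq0 eqn_leq rs.
Qed.

(** This is the squared modulus of the Fourier coefficient ([normc_fourier_coef]), in real form so
    that the estimates avoid complex numbers. *)
Definition fourier_sq f r : R :=
  (I (fun x => f x * cos (2 * pi * r%:R * x))) ^+ 2 +
  (I (fun x => f x * sin (2 * pi * r%:R * x))) ^+ 2.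

Lemma bounded_measurable_cos r : bounded_measurable (fun x => cos (2 * pi * r%:R * x)).
Proof. by rewrite -trig10; exact: bounded_measurable_trig. Qed.

Lemma bounded_measurable_sin r : bounded_measurable (fun x => sin (2 * pi * r%:R * x)).
Proof. by rewrite -trig01; exact: bounded_measurable_trig. Qed.

Lemma normc_fourier_coef f r : bounded_measurable f ->
  ComplexField.Normc.normc (fourier_coef f r%:Z) ^+ 2 = fourier_sq f r.
Proof.
move=> bf; rewrite /fourier_coef /circle_integralC /= sqr_sqrtr ?addr_ge0 ?sqr_ge0//.
rewrite /fourier_sq; congr (_ ^+ 2 + _).
  by apply: eq_Rintegral => x _; rewrite cosN mul0r subr0.
rewrite -[RHS]sqrrN -mulN1r -circle_integralZ; last first.
  by apply: bounded_measurableM => //; exact: bounded_measurable_sin.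
by congr (_ ^+ 2); apply: eq_Rintegral => x _; rewrite sinN mul0r addr0; ring.
Qed.

Lemma circle_integral_mul_trig f r a b : bounded_measurable f ->
  I (fun x => f x * trig r a b x) =
  a * I (fun x => f x * cos (2 * pi * r%:R * x)) +
  b * I (fun x => f x * sin (2 * pi * r%:R * x)).
Proof.
move=> bf.
have bc := bounded_measurableM bf (bounded_measurable_cos r).
have bs := bounded_measurableM bf (bounded_measurable_sin r).
rewrite -!circle_integralZ// -circle_integralD.
- by apply: eq_Rintegral => x _; rewrite /trig; ring.
- exact: bounded_measurableM (bounded_measurable_cst _) bc.
- exact: bounded_measurableM (bounded_measurable_cst _) bs.
Qed.

(** The factor 2 accounts for the frequencies r and -r of a real function. Here 2 g is the
    orthogonal projection of f onto the frequencies of F, and the bound is the integral of (f - 2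
    g)^2 >= 0. *)
Lemma bessel f (F : seq nat) : bounded_measurable f -> uniq F ->
  (forall r, r \in F -> (0 < r)%N) ->
  2 * \sum_(r <- F) fourier_sq f r <= I (fun x => f x ^+ 2).
Proof.
move=> bf uF F0.
pose A r := I (fun x => f x * cos (2 * pi * r%:R * x)).
pose B r := I (fun x => f x * sin (2 * pi * r%:R * x)).
pose u r := trig r (A r) (B r).
have bu r : bounded_measurable (u r) by exact: bounded_measurable_trig.
pose g x := \sum_(r <- F) u r x.
have bg : bounded_measurable g by exact: bounded_measurable_sum.
set S := \sum_(r <- F) _.
have fg : I (fun x => f x * g x) = S.
  under eq_Rintegral do rewrite /g big_distrr /=.
  rewrite circle_integral_sum; last by move=> r _; exact: bounded_measurableM.
  by apply: eq_bigr => r _; rewrite circle_integral_mul_trig// /fourier_sq !expr2.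
have gg : I (fun x => g x * g x) = S / 2.
  under eq_Rintegral do rewrite /g big_distrl /=.
  rewrite circle_integral_sum; last by move=> r _; exact: bounded_measurableM.
  rewrite /S big_distrl /= big_seq [RHS]big_seq; apply: eq_bigr => r rF.
  under eq_Rintegral do rewrite big_distrr /=.
  rewrite circle_integral_sum; last by move=> s _; exact: bounded_measurableM.
  rewrite (bigD1_seq r)//= big_seq_cond big1 => [|s /andP[sF sr]].
    by rewrite circle_integral_trigM ?F0// eqxx addr0 mulr1 /fourier_sq !expr2.
  by rewrite circle_integral_trigM ?F0// eq_sym (negbTE sr) mulr0.
have : I (fun x => 4 * (f x * g x) + (-4) * (g x * g x)) <= I (fun x => f x ^+ 2).
  apply: le_circle_integral => [||x].
  - by apply: bounded_measurableD; apply: bounded_measurableM;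
      try exact: bounded_measurable_cst; exact: bounded_measurableM.
  - by under eq_fun do rewrite expr2; exact: bounded_measurableM.
  - by have := sqr_ge0 (f x - 2 * g x); nra.
rewrite circle_integralD; last 2 first.
- by apply: bounded_measurableM; [exact: bounded_measurable_cst | exact: bounded_measurableM].
- by apply: bounded_measurableM; [exact: bounded_measurable_cst | exact: bounded_measurableM].
by rewrite !circle_integralZ ?fg ?gg; try exact: bounded_measurableM; lra.
Qed.

Lemma le_L2norm f (y : R) : bounded_measurable f -> 0 <= y ->
  y ^+ 2 <= I (fun x => f x ^+ 2) -> (y%:E <= L2norm f)%E.
Proof.
move=> bf y0 yf; rewrite /L2norm unlock /=.
have -> : (\int[mu]_x (`|((EFin \o f) \_ `[0%R, 1%R]) x| `^ 2) =
    (I (fun x => f x ^+ 2))%:E)%E.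
  rewrite /Rintegral fineK; last first.
    have bf2 : bounded_measurable (fun x => f x ^+ 2).
      by under eq_fun do rewrite expr2; exact: bounded_measurableM.
    exact: integrable_fin_num (bounded_measurable_integrable _ _ _ _ bf2).
  rewrite [RHS]integral_mkcond; apply: eq_integral => x _.
  rewrite /patch; case: ifP => _ /=; first by rewrite powR_mulrn// real_normK// num_real.
  by rewrite normr0 powR0.
rewrite poweR_EFin lee_fin powR12_sqrt ?(le_trans _ yf) ?sqr_ge0//.
by rewrite -[leLHS](ger0_norm y0) -sqrtr_sqr ler_sqrt// (le_trans _ yf) ?sqr_ge0.
Qed.

Lemma ergodic_sum_bounded_measurable phi alpha n :
  bounded_measurable phi -> bounded_measurable (ergodic_sum phi alpha n).
Proof.
by move=> bp; apply: bounded_measurable_sum => j _; exact: bounded_measurable_translate.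
Qed.

Let trigD r a b x y : trig r a b (x + y) =
  trig r (a * cos (2 * pi * r%:R * y) + b * sin (2 * pi * r%:R * y))
    (b * cos (2 * pi * r%:R * y) - a * sin (2 * pi * r%:R * y)) x.
Proof. by rewrite /trig mulrDr cosD sinD; ring. Qed.

(** C + i S is the geometric sum of the e^(ijt), and |1 - e^(is)|^2 = 2 (1 - cos s). The product
    form avoids dividing by 1 - cos t, which may vanish. *)
Lemma dirichlet_kernel t n :
  let C := \sum_(0 <= j < n) cos (j%:R * t) in
  let S := \sum_(0 <= j < n) sin (j%:R * t) in
  (C ^+ 2 + S ^+ 2) * (1 - cos t) = 1 - cos (n%:R * t).
Proof.
move=> C S.
(* Real and imaginary parts of (C + i S) (1 - e^(it)) = 1 - e^(int); taking squared moduli then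
   gives the claim. *)
have [h1 h2] : C * (1 - cos t) + S * sin t = 1 - cos (n%:R * t) /\
    S * (1 - cos t) - C * sin t = - sin (n%:R * t).
  rewrite {}/C {}/S; elim: n => [|n [IH1 IH2]].
    by rewrite !big_nil mulr0n !mul0r cos0 sin0; split; ring.
  have -> : n.+1%:R * t = n%:R * t + t by rewrite -natr1 mulrDl mul1r.
  rewrite !big_nat_recr//= cosD sinD; split; last by lra.
  by lra.
have ct := cos2Dsin2 t; have cn := cos2Dsin2 (n%:R * t).
move: h1 h2 ct cn; move: (cos t) (sin t) (cos (n%:R * t)) (sin (n%:R * t)) C S => c s d e C S h1 h2 ct cn.
have : (C * (1 - c) + S * s) ^+ 2 + (S * (1 - c) - C * s) ^+ 2 =
  (C ^+ 2 + S ^+ 2) * (1 - 2 * c + (c ^+ 2 + s ^+ 2)) by ring.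
rewrite h1 h2 ct.
have -> : (1 - d) ^+ 2 + (- e) ^+ 2 = 1 - 2 * d + (d ^+ 2 + e ^+ 2) by ring.
rewrite cn; lra.
Qed.

(** Translating phi by j alpha rotates its pair of cosine and sine coefficients by the angle j t;
    summing over j multiplies the squared modulus by C ^+ 2 + S ^+ 2. *)
Lemma fourier_sq_ergodic_sum phi alpha n r :
  bounded_measurable phi -> periodic phi 1 ->
  fourier_sq (ergodic_sum phi alpha n) r * (1 - cos (2 * pi * r%:R * alpha)) =
  fourier_sq phi r * (1 - cos (n%:R * (2 * pi * r%:R * alpha))).
Proof.
move=> bp pp; rewrite -dirichlet_kernel.
set t := 2 * pi * r%:R * alpha.
pose A := I (fun x => phi x * cos (2 * pi * r%:R * x)).
pose B := I (fun x => phi x * sin (2 * pi * r%:R * x)).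
have shift a b y : I (fun x => phi (x + y) * trig r a b x) =
    (a * cos (2 * pi * r%:R * y) - b * sin (2 * pi * r%:R * y)) * A +
    (b * cos (2 * pi * r%:R * y) + a * sin (2 * pi * r%:R * y)) * B.
  transitivity (I (fun x => phi x * trig r a b (x - y))).
    rewrite -(circle_integral_translate y (f := fun x => phi x * trig r a b (x - y))).
    - by apply: eq_Rintegral => x _; rewrite addrK.
    - apply: bounded_measurableM => //; apply: bounded_measurable_translate.
      exact: bounded_measurable_trig.
    - by move=> x; rewrite pp addrAC periodic_trig.
  under eq_Rintegral do rewrite trigD mulrN cosN sinN !mulrN opprK.
  by rewrite circle_integral_mul_trig.
have sums a b : I (fun x => ergodic_sum phi alpha n x * trig r a b x) =
    \sum_(0 <= j < n) ((a * cos (j%:R * t) - b * sin (j%:R * t)) * A +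
      (b * cos (j%:R * t) + a * sin (j%:R * t)) * B).
  under eq_Rintegral do rewrite /ergodic_sum big_distrl /=.
  rewrite circle_integral_sum => [|j _]; last first.
    apply: bounded_measurableM; last exact: bounded_measurable_trig.
    exact: bounded_measurable_translate.
  apply: eq_bigr => j _; rewrite shift.
  by have -> : 2 * pi * r%:R * (j%:R * alpha) = j%:R * t by rewrite /t; ring.
have := sums 1 0; have := sums 0 1; rewrite trig10 trig01 /fourier_sq => -> ->.
under [X in X ^+ 2 + _]eq_bigr do rewrite !mul0r !mul1r subr0 add0r.
under [X in _ + X ^+ 2]eq_bigr do rewrite !mul0r !mul1r addr0 sub0r.
by rewrite !big_split /= -!big_distrl /= sumrN -/A -/B; ring.
Qed.

End Trigonometric.

(** * Cosine bounds and continued fractions *)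

Section CosineBounds.
Variable R : realType.
Implicit Types (t y : R).

Lemma sin_mvt y : 0 <= y -> exists2 c, 0 <= c <= y & sin y = cos c * y.
Proof.
move=> y0; have [|c cy] := @MVT_segment R sin cos 0 y y0.
  by apply: continuous_subspaceT => x; exact: continuous_sin.
by rewrite sin0 !subr0 => ->; exists c => //; rewrite in_itv /= in cy.
Qed.

Lemma one_minus_cos y : 1 - cos y = 2 * sin (y / 2) ^+ 2.
Proof.
have {1}-> : y = (y / 2) *+ 2 by rewrite -mulr_natr; field.
by rewrite cos_mulr2n cos2sin2 -mulr_natr; ring.
Qed.

Lemma one_minus_cos_le y : 1 - cos y <= y ^+ 2 / 2.
Proof.
wlog y0 : y / 0 <= y.
  move=> hw; have [/hw//|/ltW y0] := leP 0 y.
  by rewrite -cosN -sqrrN hw// oppr_ge0.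
rewrite one_minus_cos; have [|c _ ->] := @sin_mvt (y / 2); first lra.
rewrite exprMn (_ : y ^+ 2 / 2 = 2 * (1 * (y / 2) ^+ 2)); last by field.
by rewrite ler_pM2l// ler_wpM2r ?sqr_ge0//.
Qed.

(** On [0, 1] the mean value theorem applies with cos c >= 1 - c^2 / 2 >= 1 / 2. Beyond 1,
    monotonicity gives sin y >= sin 1 >= 1 / 2, while y < 2. *)
Lemma sin_ge_quarter y : 0 <= y <= pi / 2 -> y / 4 <= sin y.
Proof.
have small (z : R) : 0 <= z <= 1 -> z / 2 <= sin z.
  move=> /andP[z0 z1]; have [c /andP[c0 cz] ->] := sin_mvt z0.
  by have := one_minus_cos_le c; nra.
move=> /andP[y0 yp]; have [y1|/ltW y1] := leP y 1.
  by have := small y; rewrite y0 y1 => /(_ isT); lra.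
have p1 : 1 <= pi / 2 :> R := @pihalf_ge1 R.
have p2 : pi / 2 < 2 :> R := @pihalf_lt2 R.
have : sin 1 <= sin y.
  have [<-//|y1'] := eqVneq 1 y.
  by apply/ltW; rewrite ltr_sin ?lt_neqAle ?y1' ?y1// in_itv /=; lra.
have := small 1; rewrite ler01 lexx => /(_ isT); lra.
Qed.

Lemma one_minus_cos_ge t : `|t| <= 2^-1 -> t ^+ 2 / 2 <= 1 - cos (2 * pi * t).
Proof.
wlog t0 : t / 0 <= t.
  move=> hw; have [/hw//|/ltW t0 th] := leP 0 t.
  by rewrite -cosN -sqrrN -mulrN hw ?normrN// oppr_ge0.
rewrite ger0_norm// => t1; have p2 : 2 <= pi :> R := @pi_ge2 R.
rewrite one_minus_cos; have -> : 2 * pi * t / 2 = pi * t by field.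
have : t / 2 <= sin (pi * t).
  by apply: le_trans (sin_ge_quarter _); [|apply/andP; split]; nra.
by move: (sin _) => s; nra.
Qed.

Lemma cosD2piz (z : int) t : cos (t + 2 * pi * z%:~R) = cos t.
Proof.
case: z => n; first by rewrite -pmulrn cosD2pin.
by rewrite NegzE mulrNz -pmulrn -(cosD2pin n.+1 (t + _)) mulrN subrK.
Qed.

End CosineBounds.

(** * Growth of the denominators and distances to the integers *)

Section ContinuedFractionBounds.
Variables (R : realType) (alpha : R).
Hypotheses (alpha01 : 0 < alpha < 1) (irr : irrational alpha).

Local Notation q := (cf_denominator alpha).
Local Notation a := (partial_quotient alpha).
Let x k := iter k (@gauss_map R) alpha.

(** Irrationality passes to the Gauss image, which therefore never vanishes: the expansion does not
    stop. *)
Let gauss_iter_irrational k : irrational (x k) /\ 0 < x k < 1.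
Proof.
elim: k => [|k [xirr /andP[x0 x1]]] //.
have girr : irrational (gauss_map (x k)).
  move=> [r _ rE]; apply: xirr; exists (r + (Num.floor (x k)^-1)%:~R)^-1 => //.
  by rewrite fmorphV rmorphD /= ratr_int rE /gauss_map subrK invrK.
split => //=; rewrite -/(x k).
have := floor_le (x k)^-1; have := floorD1_gt (x k)^-1.
rewrite intrD1 => h1 h2; apply/andP; split; last by rewrite /gauss_map; lra.
rewrite lt_neqAle /gauss_map subr_ge0 h2 andbT eq_sym; apply/negP => /eqP g0.
by apply: girr; exists 0 => //; rewrite rmorph0 /gauss_map g0.
Qed.

Let x_gt0 k : 0 < x k. Proof. by have [_ /andP[]] := gauss_iter_irrational k. Qed.
Let x_lt1 k : x k < 1. Proof. by have [_ /andP[]] := gauss_iter_irrational k. Qed.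

Let x_rec k : x k * ((a k.+1)%:R + x k.+1) = 1.
Proof.
have -> : (a k.+1)%:R + x k.+1 = (x k)^-1; last by rewrite divff ?gt_eqF.
rewrite /= /gauss_map -/(x k) truncEfloor.
have : 0 <= Num.floor (x k)^-1 by rewrite floor_ge0 invr_ge0 ltW.
by case: (Num.floor _) => // n _; rewrite -pmulrn addrC subrK.
Qed.

Let a_gt0 k : (0 < a k.+1)%N.
Proof. by rewrite /= truncn_gt0 -/(x k) invf_ge1 ?ltW. Qed.

Lemma cf_denominator_gt0 k : (0 < q k)%N.
Proof.
suff : (0 < q k)%N && (0 < q k.+1)%N by case/andP.
elim: k => [|k /andP[h1 h2]]; first by rewrite a_gt0.
by rewrite h2 /= addn_gt0 h1 orbT.
Qed.

Lemma cf_denominatorSS k : q k.+2 = (a k.+2 * q k.+1 + q k)%N.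
Proof. by []. Qed.

Lemma leq_partial_quotient_cf_denominator k : (a k.+1 * q k <= q k.+1)%N.
Proof. by case: k => [|k]; [rewrite muln1 | rewrite cf_denominatorSS leq_addr]. Qed.

Lemma cf_denominator_ltS k : (q k.+1 < q k.+2)%N.
Proof.
rewrite cf_denominatorSS -addn1 leq_add ?cf_denominator_gt0//.
by rewrite leq_pmull// a_gt0.
Qed.

Lemma cf_denominator_leS k : (q k <= q k.+1)%N.
Proof.
by case: k => [|k]; [rewrite cf_denominator_gt0 | rewrite ltnW// cf_denominator_ltS].
Qed.

Lemma cf_denominator_le : {homo q : i j / (i <= j)%N}.
Proof. exact: (homo_leq leqnn leq_trans cf_denominator_leS). Qed.

(** The denominators increase strictly only from index 1 on: q_1 = a_1 may equal q_0 = 1. *)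
Lemma cf_denominator_inj i j : (0 < i)%N -> (0 < j)%N -> q i = q j -> i = j.
Proof.
case: i j => // i [|j] // _ _ eqq.
have mono : {mono (fun k => q k.+1) : u v / (u <= v)%N}.
  by apply: leq_mono; apply: (homo_ltn ltn_trans) => k; exact: cf_denominator_ltS.
by congr S; apply/eqP; rewrite eqn_leq -(mono i j) -(mono j i) [q _]eqq leqnn.
Qed.

Lemma leq_cf_denominator k : (k <= q k)%N.
Proof.
case: k => // k; elim: k => [|k IH]; first exact: cf_denominator_gt0.
exact: leq_ltn_trans IH (cf_denominator_ltS k).
Qed.

Lemma cf_denominator_double k : (2 * q k <= q k.+2)%N.
Proof.
rewrite cf_denominatorSS mul2n -addnn leq_add2r.
by rewrite (leq_trans (cf_denominator_leS k))// leq_pmull// a_gt0.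
Qed.

Lemma sum_inv_cf_denominator n : \sum_(0 <= k < n) (q k)%:R^-1 <= 4 :> R.
Proof.
have q0 k : 0 < (q k)%:R :> R by rewrite ltr0n cf_denominator_gt0.
(* This quantity does not increase with n, since 2 / q_(n+2) <= 1 / q_n, and it is at most 4 at n =
   0. *)
suff : \sum_(0 <= k < n) (q k)%:R^-1 + 2 * (q n)%:R^-1 + 2 * (q n.+1)%:R^-1 <= 4 :> R.
  apply: le_trans; rewrite -addrA lerDl addr_ge0// mulr_ge0// invr_ge0 ltW//.
elim: n => [|n IH].
  rewrite big_nil add0r.
  have : (q 1)%:R^-1 <= 1 :> R by rewrite invf_le1// ler1n cf_denominator_gt0.
  by rewrite invr1; lra.
have : 2 * (q n.+2)%:R^-1 <= (q n)%:R^-1 :> R.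
  rewrite -[leRHS]mul1r ler_pdivlMr// mulrAC ler_pdivrMr// mul1r -natrM ler_nat.
  exact: cf_denominator_double.
by rewrite big_nat_recr//=; lra.
Qed.

(** The classical product for |q_k alpha - p_k|, with p_k the numerator of the convergent;
    [cf_distanceP] gives the signed form without defining p_k. *)
Definition cf_distance k : R := \prod_(i < k.+1) iter i (@gauss_map R) alpha.
Local Notation d := cf_distance.

Let d0 : d 0 = alpha.
Proof. by rewrite /cf_distance big_ord_recr big_ord0 /= mul1r. Qed.

Let dS k : d k.+1 = d k * x k.+1. Proof. by rewrite /cf_distance big_ord_recr. Qed.

Lemma cf_distance_gt0 k : 0 < d k.
Proof. by apply: prodr_gt0 => i _; exact: x_gt0. Qed.

Let d_rec k : d k = (a k.+2)%:R * d k.+1 + d k.+2.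
Proof.
transitivity (d k * (x k.+1 * ((a k.+2)%:R + x k.+2))); first by rewrite x_rec mulr1.
by rewrite !dS; ring.
Qed.

Let d_le k : d k.+1 <= d k.
Proof. by rewrite dS ger_pMr ?cf_distance_gt0// ltW. Qed.

(** The recurrences of q and d compensate, so the sum does not depend on k. Both terms are positive
    and the second is at most the first, whence the two bounds on [d k] below. *)
Let qd_sum k : (q k.+1)%:R * d k + (q k)%:R * d k.+1 = 1.
Proof.
elim: k => [|k IH].
  by rewrite dS d0 mulr1n mul1r mulrC -mulrDr; exact: (x_rec 0).
by rewrite -[RHS]IH cf_denominatorSS natrD natrM (d_rec k); ring.
Qed.

Lemma cf_distance_le k : (q k.+1)%:R * d k <= 1.
Proof.
by rewrite -[leRHS](qd_sum k) lerDl mulr_ge0// ltW// cf_distance_gt0.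
Qed.

Lemma cf_distance_ge k : 1 <= 2 * (q k.+1)%:R * d k.
Proof.
rewrite -[leLHS](qd_sum k) -mulrA mulrDl mul1r lerD2l.
apply: ler_pM => //; first by rewrite ltW// cf_distance_gt0.
by rewrite ler_nat cf_denominator_leS.
Qed.

Lemma cf_distanceP k : exists p : int, (q k)%:R * alpha = p%:~R + (-1) ^+ k * d k.
Proof.
suff [] : (exists p : int, (q k)%:R * alpha = p%:~R + (-1) ^+ k * d k) /\
  (exists p : int, (q k.+1)%:R * alpha = p%:~R + (-1) ^+ k.+1 * d k.+1) by [].
elim: k => [|k [[p pE] [p' pE']]].
  split; first by exists 0; rewrite add0r expr0 d0.
  exists 1; have := qd_sum 0; rewrite d0 !mul1r expr1 => h.
  by rewrite -[1%:~R]h; ring.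
split; first by exists p'.
exists ((a k.+2)%:Z * p' + p).
rewrite cf_denominatorSS natrD natrM mulrDl -mulrA pE pE' (d_rec k) intrD intrM !exprS -pmulrn.
by ring.
Qed.

(** Modulo 1, n q_k alpha is n d_k up to sign, and the cosine is even. *)
Lemma cos_cf_distance n k :
  cos (n%:R * (2 * pi * (q k)%:R * alpha)) = cos (2 * pi * (n%:R * d k)).
Proof.
have [p pE] := cf_distanceP k.
have -> : n%:R * (2 * pi * (q k)%:R * alpha) =
    (-1) ^+ k * (2 * pi * (n%:R * d k)) + 2 * pi * (n%:Z * p)%:~R.
  by rewrite -!mulrA pE intrM -pmulrn; ring.
rewrite cosD2piz -signr_odd; case: (odd k); last by rewrite mul1r.
by rewrite expr1 mulN1r cosN.
Qed.

(** * The index m(n) *)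

Lemma cf_index_ex n : (0 < n)%N -> exists m, (q m <= n < q m.+1)%N.
Proof.
move=> n0; have ex : exists m, (n < q m)%N.
  by exists n.+1; exact: leq_cf_denominator.
have [[|m] nm mmin] := ex_minnP ex; first by rewrite ltnNge n0 in nm.
by exists m; rewrite nm andbT leqNgt; apply/negP => /mmin; rewrite ltnn.
Qed.

Lemma cf_indexP n : (0 < n)%N -> (q (cf_index alpha n) <= n < q (cf_index alpha n).+1)%N.
Proof.
move=> /cf_index_ex[m mP]; rewrite /cf_index.
by case: xgetP => [k _ //|/(_ m)] /=; rewrite mP => /(_ isT).
Qed.

Lemma cf_index_le n N : (0 < n <= N)%N -> (cf_index alpha n <= cf_index alpha N)%N.
Proof.
move=> /andP[n0 nN]; have /andP[h1 _] := cf_indexP n0.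
have /andP[_ h2] := cf_indexP (leq_trans n0 nN).
rewrite leqNgt; apply/negP => /cf_denominator_le h3.
by have := leq_ltn_trans (leq_trans h3 (leq_trans h1 nN)) h2; rewrite ltnn.
Qed.

Lemma cf_index_ge k n : (q k <= n)%N -> (k <= cf_index alpha n)%N.
Proof.
move=> kn; have n0 := leq_trans (cf_denominator_gt0 k) kn.
have /andP[_ h] := cf_indexP n0; rewrite leqNgt; apply/negP => /cf_denominator_le h3.
by have := leq_ltn_trans (leq_trans h3 kn) h; rewrite ltnn.
Qed.

End ContinuedFractionBounds.

(** * Counting *)

Section Counting.
Variable R : realType.
Implicit Types (d eps L : R) (n N Q k : nat).

(** Turns cardinalities into sums of indicators, which can be compared termwise and exchanged. *)
Lemma card_fset_set_nat_itv (A : set nat) m N :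
  #|` fset_set ([set n | (m <= n < N)%N] `&` A)| = (\sum_(m <= n < N) (n \in A))%N.
Proof.
have -> : [set n | (m <= n < N)%N] `&` A =
    [set` [fset n in [seq n <- index_iota m N | n \in A]]%fset].
  apply/seteqP; split => n /=; rewrite in_fset /= mem_filter mem_index_iota.
    by move=> [-> /mem_set ->].
  by move=> /andP[/set_mem ? ->].
rewrite set_fsetK card_fseq undup_id ?filter_uniq ?iota_uniq//.
by rewrite size_filter -sum1_count big_mkcond; apply: eq_bigr => n _; case: (n \in A).
Qed.

Lemma sum_indicator_spread (P : pred nat) N L : 0 <= L ->
  (forall i j, (i <= j < N)%N -> P i -> P j -> (j - i)%:R <= L) ->
  (\sum_(0 <= n < N) P n)%:R <= L + 1.
Proof.
move=> L0 PL; set s := (\sum_(0 <= n < N) _)%N.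
(* The induction keeps the first and last elements i and j found so far; the count is at most the
   number of integers between them. *)
suff [->|[i [j [ij Pi Pj sij]]]] :
    s = 0%N \/ exists i j, [/\ (i <= j < N)%N, P i, P j & (s <= j - i + 1)%N].
- by rewrite addr_ge0.
- rewrite (@le_trans _ _ (j - i + 1)%:R) ?ler_nat// natrD lerD2r.
  exact: PL.
rewrite /s {s PL}; elim: N => [|N IH]; first by left; rewrite big_nil.
rewrite big_nat_recr//=; case PN : (P N); last first.
  rewrite addn0; case: IH => [->|[i [j [ij Pi Pj s]]]]; [by left | right].
  by exists i, j; split => //; case/andP: ij => -> /= /ltnW.
right; case: IH => [->|[i [j [ij Pi Pj s]]]].
  by exists N, N; split; rewrite ?leqnn ?ltnSn ?subnn.
by exists i, N; split => //; move: ij s; lia.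
Qed.

(* The points n d, n < N, make at most N d + 2 turns around the circle, and on
   each of them at most 4 eps / d + 1 values of n satisfy ||n d|| < 2 eps. *)
Lemma count_small_rotation d eps N Q : 0 < eps -> 0 < d -> (0 < Q <= N)%N ->
  Q%:R * d <= 1 -> 1 <= 2 * Q%:R * d ->
  (\sum_(0 <= n < N) (1 - cos (2 * pi * (n%:R * d)) < eps ^+ 2)%R)%:R <=
  20 * eps * N%:R + 3 * N%:R / Q%:R.
Proof.
move=> e0 d0 /andP[Q0 QN] Qd1 Qd2.
(* Adding 1 / 2 before truncating gives the nearest integer; K bounds the integers k nearest to some
   n d with n < N. *)
pose K := Num.truncn (N%:R * d + 2^-1).
pose F k n := `|n%:R * d - k%:R| < 2 * eps.
have Nd0 : 0 <= N%:R * d by rewrite mulr_ge0 ?ler0n ?ltW.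
have near n : (n < N)%N -> 1 - cos (2 * pi * (n%:R * d)) < eps ^+ 2 ->
    exists2 k, (k < K.+1)%N & F k n.
  move=> nN nsmall; pose y := n%:R * d + 2^-1; pose k := Num.truncn y.
  have nd0 : 0 <= n%:R * d by rewrite mulr_ge0 ?ler0n ?ltW.
  have ndN : n%:R * d <= N%:R * d by rewrite ler_pM2r// ler_nat ltnW.
  exists k; first by rewrite ltnS; apply: le_truncn; rewrite /y; lra.
  have [h1 h2] : k%:R <= y /\ y < k%:R + 1.
    have /truncn_itv/andP[] : 0 <= y by rewrite /y; lra.
    by rewrite natr1 -/k.
  set t := n%:R * d - k%:R.
  have th : `|t| <= 2^-1 by rewrite ler_norml /t; rewrite /y in h1 h2; lra.
  have := one_minus_cos_ge th.
  have -> : cos (2 * pi * t) = cos (2 * pi * (n%:R * d)).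
    by rewrite -(cosD2pin k (2 * pi * t)); congr cos; rewrite /t; ring.
  (* From t^2 / 2 < eps^2 follows |t| < 2 eps. *)
  rewrite /F -/t -(real_normK (num_real t)) => ht.
  rewrite -(ltr_pXn2r (n := 2)) ?nnegrE ?mulr_ge0// ?ltW// exprMn.
  by have := exprn_gt0 2 e0; lra.
have fiber k : (\sum_(0 <= n < N) F k n)%:R <= 4 * eps / d + 1.
  apply: sum_indicator_spread => [|i j /andP[ij jN]].
    by rewrite divr_ge0 ?mulr_ge0// ltW.
  rewrite /F !ltr_norml => /andP[i1 i2] /andP[j1 j2].
  by rewrite natrB// ler_pdivlMr// mulrBl; lra.
have step1 : (\sum_(0 <= n < N) (1 - cos (2 * pi * (n%:R * d)) < eps ^+ 2)%R
    <= \sum_(0 <= k < K.+1) \sum_(0 <= n < N) F k n)%N.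
  rewrite exchange_big_nat /= !big_nat; apply: leq_sum => n /andP[_ nN].
  case: (boolP (_ < _)%R) => // /(near _ nN)[k kK Fkn].
  by rewrite (bigD1_seq k) ?mem_index_iota ?iota_uniq//= Fkn leq_addr.
have step2 : (\sum_(0 <= k < K.+1) \sum_(0 <= n < N) F k n)%:R <=
    (K%:R + 1) * (4 * eps / d + 1).
  rewrite natr_sum (le_trans (ler_sum _ (fun k _ => fiber k)))//.
  by rewrite sumr_const_nat subn0 -[leLHS]mulr_natl natr1.
have K2 : K%:R <= N%:R * d + 2^-1.
  by have /truncn_itv/andP[] : 0 <= N%:R * d + 2^-1; lra.
have ed : eps / d <= 2 * eps * Q%:R.
  rewrite ler_pdivrMr// -[leLHS]mulr1 (_ : _ * d = eps * (2 * Q%:R * d)); last by ring.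
  by rewrite ler_pM2l.
have QN' : Q%:R <= N%:R :> R by rewrite ler_nat.
have Q0' : 0 < Q%:R :> R by rewrite ltr0n.
have NQ : N%:R * d <= N%:R / Q%:R.
  by rewrite ler_pdivlMr// -mulrA ler_piMr// mulrC.
have NQ1 : 1 <= N%:R / Q%:R :> R by rewrite ler_pdivlMr// mul1r.
have ed0 : 0 <= eps / d by rewrite divr_ge0 ?ltW.
apply: (@le_trans _ _ ((N%:R * d + 2) * (4 * (eps / d) + 1))).
  apply: le_trans (le_trans step2 _); first by rewrite ler_nat.
  by rewrite -(mulrA 4) ler_wpM2r//; lra.
(* Since eps / d <= 2 eps Q <= 2 eps N, the terms in eps sum to at most 20 eps N; the rest, N d + 2,
   is at most 3 N / Q. *)
have -> : (N%:R * d + 2) * (4 * (eps / d) + 1) =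
  4 * eps * N%:R + N%:R * d + 8 * (eps / d) + 2 by field; rewrite gt_eqF.
by have : eps * Q%:R <= eps * N%:R; [rewrite ler_pM2l | lra].
Qed.

Lemma markov_sum (N m : nat) (B : nat -> nat -> bool) (c : R) (b : nat -> R) :
  (forall j, (0 < j < m)%N -> (\sum_(0 <= n < N) B j n)%:R <= b j) ->
  (\sum_(0 <= n < N) (c <= (\sum_(1 <= j < m) B j n)%:R)%R)%:R * c <=
  \sum_(1 <= j < m) b j.
Proof.
move=> Bb; rewrite natr_sum big_distrl /=.
apply: (@le_trans _ _ (\sum_(0 <= n < N) (\sum_(1 <= j < m) B j n)%:R)).
  apply: ler_sum => n _; case: (boolP (c <= _)) => h; first by rewrite mul1r.
  by rewrite mul0r.
rewrite -natr_sum exchange_big_nat natr_sum !big_nat; apply: ler_sum => j jm.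
exact: Bb.
Qed.

(** * Growth of x / ln x *)

Lemma ln_ge_1B y : 0 < y -> 1 - y^-1 <= ln y :> R.
Proof.
move=> y0; have := @le_ln1Dx R (y^-1 - 1).
rewrite [1 + _]addrC subrK lnV ?posrE// => h.
suff : - ln y <= y^-1 - 1 by lra.
by apply: h; have : 0 < y^-1; [rewrite invr_gt0 | lra].
Qed.

(* x / ln x is not monotone on [2, e], whence the factor 2. *)
Lemma div_ln_le (x y : R) : 2 <= x -> x <= y -> x / ln x <= 2 * (y / ln y).
Proof.
move=> x2 xy.
have x0 : 0 < x by lra.
have y0 : 0 < y by lra.
have lx : 2^-1 <= ln x.
  apply: le_trans (ln_ge_1B x0).
  by have : x^-1 <= 2^-1; [rewrite lef_pV2 ?posrE | lra].
have lxy : ln x <= ln y by rewrite ler_ln ?posrE.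
(* Concavity of ln. As ln x >= 1 / 2, y - x is at most 2 (y - x) ln x, and the right side is at most
   2 y ln x. *)
have lyx : x * ln y <= x * ln x + (y - x).
  have := @le_ln1Dx R (y / x - 1); rewrite [1 + _]addrC subrK ln_div ?posrE// => h.
  have : ln y - ln x <= y / x - 1.
    by apply: h; have : 0 < y / x; [rewrite divr_gt0 | lra].
  rewrite -(ler_pM2l x0) !mulrBr mulr1 mulrCA divff ?gt_eqF//; lra.
rewrite ler_pdivrMr ?(lt_le_trans _ lx)// mulrA mulrAC ler_pdivlMr; last by lra.
by nra.
Qed.

End Counting.

(** * The variance of ergodic sums *)

Section VarianceLowerBound.
Variables (R : realType) (alpha : R) (phi : R -> R) (eta : R).
Hypotheses (alpha01 : 0 < alpha < 1) (irr : irrational alpha).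
Hypotheses (bphi : bounded_measurable phi) (pphi : periodic phi 1).
Hypothesis eta_gt0 : 0 < eta.

Local Notation q := (cf_denominator alpha).
Local Notation a := (partial_quotient alpha).
Local Notation d := (cf_distance alpha).
Local Notation mu := (@lebesgue_measure R).

Definition resonant (j : nat) : bool :=
  eta <= (a j.+1)%:R * ComplexField.Normc.normc (gamma_coef phi (Posz (q j))).

Definition nearly_periodic (eps : R) (j n : nat) : bool :=
  1 - cos (2 * pi * (n%:R * d j)) < eps ^+ 2.

Lemma fourier_sq_ergodic_sum_ge (eps : R) j n : (0 < j)%N -> resonant j ->
  ~~ nearly_periodic eps j n ->
  eta ^+ 2 * eps ^+ 2 / 32 <= fourier_sq (ergodic_sum phi alpha n) (q j).
Proof.
move=> j0; rewrite /resonant /nearly_periodic -leNgt => resj far.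
have bn := ergodic_sum_bounded_measurable alpha n bphi.
have := fourier_sq_ergodic_sum alpha n (q j) bphi pphi.
rewrite cos_cf_distance//.
have -> : cos (2 * pi * (q j)%:R * alpha) = cos (2 * pi * d j).
  by have := cos_cf_distance alpha01 irr 1 j; rewrite !mul1r.
set Fn := fourier_sq (ergodic_sum _ _ _) _; set F := fourier_sq phi _ => E.
have Fn0 : 0 <= Fn by rewrite addr_ge0 ?sqr_ge0.
have F0 : 0 <= F by rewrite addr_ge0 ?sqr_ge0.
have d0 : 0 < d j by exact: cf_distance_gt0.
(* The bound pi <= 4 gives (8 d_j)^2 / 2, the source of the constant 32. *)
have small : 1 - cos (2 * pi * d j) <= 32 * d j ^+ 2.
  apply: (le_trans (one_minus_cos_le _)).
  have p4 : pi <= 4 :> R by have := @pihalf_lt2 R; lra.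
  have p0 := @pi_ge0 R.
  have : (2 * pi * d j) ^+ 2 <= (8 * d j) ^+ 2.
    have h0 : 0 <= 2 * pi * d j by rewrite !mulr_ge0// ltW.
    by rewrite !expr2 ler_pM// ler_pM2r//; lra.
  by have -> : 32 * d j ^+ 2 = (8 * d j) ^+ 2 / 2; [field | lra].
have step : F * eps ^+ 2 <= Fn * (32 * d j ^+ 2).
  apply: (@le_trans _ _ (F * (1 - cos (2 * pi * (n%:R * d j))))).
    by rewrite ler_wpM2l.
  by rewrite -E ler_wpM2l.
(* A is the factor in front of the Fourier coefficient in the resonance condition, and A d_j <=
   q_(j+1) d_j <= 1. *)
pose A := (a j.+1)%:R * (q j)%:R : R.
have A0 : 0 <= A by rewrite mulr_ge0.
have Ad : A * d j <= 1.
  apply: le_trans (cf_distance_le alpha01 irr j).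
  rewrite ler_pM2r// /A -natrM ler_nat.
  exact: leq_partial_quotient_cf_denominator.
have etaF : eta ^+ 2 <= A ^+ 2 * F.
  rewrite /F -normc_fourier_coef// -exprMn.
  have nF : 0 <= ComplexField.Normc.normc (fourier_coef phi (Posz (q j))).
    by case: (fourier_coef _ _) => u v; exact: sqrtr_ge0.
  have eF : eta <= A * ComplexField.Normc.normc (fourier_coef phi (Posz (q j))).
    apply: (le_trans resj); rewrite /gamma_coef ComplexField.Normc.normcM /A -mulrA.
    rewrite -pmulrn -(rmorph_nat (real_complex R)) /=.
    by rewrite expr0n addr0 sqrtr_sqr ger0_norm.
  by rewrite !expr2 ler_pM// ltW.
have e0 := sqr_ge0 eps.
rewrite ler_pdivrMr//.
apply: (@le_trans _ _ (A ^+ 2 * F * eps ^+ 2)); first by rewrite ler_wpM2r.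
rewrite -mulrA; apply: (@le_trans _ _ (A ^+ 2 * (Fn * (32 * d j ^+ 2)))).
  by rewrite ler_wpM2l ?sqr_ge0.
have -> : A ^+ 2 * (Fn * (32 * d j ^+ 2)) = Fn * 32 * (A * d j) ^+ 2 by ring.
by rewrite ler_piMr ?mulr_ge0// expr_le1// mulr_ge0// ltW.
Qed.

(** Bessel's inequality at the frequencies q_j, distinct because j >= 1; its factor 2 turns 1 / 32
    into 1 / 16. *)
Lemma integral_ergodic_sum_ge (eps : R) m n :
  eta ^+ 2 * eps ^+ 2 / 16 *
    (\sum_(1 <= j < m) (resonant j && ~~ nearly_periodic eps j n))%:R <=
  \int[mu]_(x in `[0, 1]) ergodic_sum phi alpha n x ^+ 2.
Proof.
have bn := ergodic_sum_bounded_measurable alpha n bphi.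
pose s := [seq j <- index_iota 1 m | resonant j && ~~ nearly_periodic eps j n].
have sP j : j \in s -> [/\ (0 < j)%N, resonant j & ~~ nearly_periodic eps j n].
  by rewrite mem_filter mem_index_iota => /andP[/andP[? ?] /andP[? _]].
have us : uniq (map q s).
  rewrite map_inj_in_uniq ?filter_uniq ?iota_uniq// => i j /sP[i0 _ _] /sP[j0 _ _].
  exact: cf_denominator_inj.
apply: le_trans (bessel bn us _); last first.
  by move=> _ /mapP[j _ ->]; exact: cf_denominator_gt0.
rewrite big_map big_filter natr_sum (_ : _ / 16 = 2 * (eta ^+ 2 * eps ^+ 2 / 32)); last by field.
rewrite -mulrA ler_pM2l// big_distrr /= [leRHS]big_mkcond !big_nat.
apply: ler_sum => j /andP[j0 _]; case: ifPn => [/andP[? ?]|_].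
  by rewrite mulr1; exact: fourier_sq_ergodic_sum_ge.
by rewrite mulr0.
Qed.

End VarianceLowerBound.

(** * The proportion of n < N in W *)

Unset Implicit Arguments.

Theorem theorem1p3 (R : realType) (alpha : R) (phi : R -> R) :
  0 < alpha < 1 -> irrational alpha -> circle_BV0 phi ->
  (exists (M : nat) (eta theta : R),
     [/\ (0 < M)%N, 0 < eta, 0 < theta &
       forall N : nat, (M <= N)%N ->
         theta * N%:R <=
         (#|` fset_set [set j : nat | (1 <= j <= N)%N /\
             eta <= (partial_quotient alpha j.+1)%:R *
               ComplexField.Normc.normc
                 (gamma_coef phi (Posz (cf_denominator alpha j)))]|)%:R :> R]) ->
  exists eta0 c : R, [/\ 0 < eta0, 0 < c &
    let W := [set n : nat | (2 <= cf_index alpha n)%N /\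
      ((eta0 * ((cf_index alpha n)%:R / ln (cf_index alpha n)%:R)
                 `^ (2^-1))%:E
       <= L2norm (ergodic_sum phi alpha n))%E] in
    forall N : nat, (1 <= N)%N -> (2 <= cf_index alpha N)%N ->
      1 - 2 * c * (ln (cf_index alpha N)%:R) `^ (- 2^-1) <=
      (#|` fset_set (W `&` [set n : nat | (0 <= n < N)%N])|)%:R / N%:R :> R].
Proof.
move=> alpha01 irr [pphi bv _] [M [eta [theta [M0 eta0 theta0 dens]]]].
have bphi := circle_BV_bounded_measurable pphi bv.
set q := cf_denominator alpha.
pose res := resonant alpha phi eta.
have {}dens m : (M < m)%N -> theta * m.-1%:R <= (\sum_(1 <= j < m) res j)%:R.
  move=> Mm; have m0 : (0 < m)%N by exact: leq_trans Mm.
  apply: (le_trans (dens m.-1 _)); first by rewrite -ltnS prednK.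
  rewrite ler_nat; set A := (X in fset_set X).
  have -> : A = [set j | (1 <= j < m)%N] `&` [set j | res j].
    by apply/seteqP; split => j /=; rewrite /A /= -(prednK m0) ltnS.
  rewrite card_fset_set_nat_itv; apply: leq_sum => j _.
  by case: (boolP (j \in _)) => // /set_mem /= ->.
(* In c, 88 / theta pays for the bad n, q_2 for the n < q_2, where m(n) >= 2 may fail, and M for the
   case m <= M. The 128 is 64 from the variance bound times the 2 of [div_ln_le]. *)
exists (eta * Num.sqrt (theta / 128)), (88 / theta + (q 2)%:R + M%:R); split.
- by rewrite mulr_gt0// sqrtr_gt0 divr_gt0.
- by rewrite addr_gt0 ?ltr0n// ltr_wpDr// divr_gt0.
set c := 88 / theta + _ + _ => W N N1; set m := cf_index alpha N => m2.
have /andP[qmN _] : (q m <= N < q m.+1)%N by exact: cf_indexP.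
have m2r : 2 <= m%:R :> R by rewrite ler_nat.
have m0r : 0 < m%:R :> R by lra.
have N0r : 0 < N%:R :> R by rewrite ltr0n.
have lnm : 0 < ln (m%:R : R) by rewrite ln_gt0//; lra.
set eps := ln m%:R `^ (- 2^-1).
have epsE : eps = (Num.sqrt (ln m%:R))^-1 by rewrite /eps powRN powR12_sqrt// ltW.
have eps0 : 0 < eps by exact: powR_gt0.
have eps2 : eps ^+ 2 = (ln m%:R)^-1 by rewrite epsE exprVn sqr_sqrtr// ltW.
have meps : m%:R^-1 <= eps.
  rewrite epsE lef_pV2 ?posrE ?sqrtr_gt0// -[leRHS](ger0_norm (ltW m0r)).
  rewrite -sqrtr_sqr ler_sqrt ?sqr_ge0//.
  by have := ln_sublinear m0r; nra.
(* If m <= M then c eps >= m eps >= 1, and the claimed lower bound is negative. *)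
have [mM|Mm] := leqP m M.
  apply: (@le_trans _ _ 0); last by rewrite divr_ge0.
  have cM : M%:R <= c by rewrite lerDr addr_ge0// divr_ge0// ltW.
  have : 1 <= m%:R * eps by rewrite mulrC -ler_pdivrMr// mul1r.
  have : m%:R <= M%:R :> R by rewrite ler_nat.
  by move=> h1 h2; have : 1 <= c * eps; [nra | lra].
pose np := nearly_periodic alpha eps.
(* Otherwise fewer than half of the guaranteed theta (m - 1) resonant indices are lost, and at least
   half contribute. *)
pose bad n := theta * m.-1%:R / 2 <= (\sum_(1 <= j < m) np j n)%:R :> R.
have goodW n : (n < N)%N -> (q 2 <= n)%N -> ~~ bad n -> W n.
  move=> nN q2n; rewrite /bad -ltNge => good.
  have mn2 : (2 <= cf_index alpha n)%N by exact: cf_index_ge.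
  split => //.
  have mnm : (cf_index alpha n <= m)%N.
    apply: cf_index_le => //; apply/andP; split; last exact: ltnW.
    by apply: leq_trans q2n; exact: cf_denominator_gt0.
  (* W is defined with m(n), while the variance bound uses m = m(N) >= m(n). *)
  have rat : (cf_index alpha n)%:R / ln (cf_index alpha n)%:R <= 2 * (m%:R / ln m%:R) :> R.
    by apply: div_ln_le; rewrite ler_nat.
  move: rat; set r := _ / _ => rat.
  have r0 : 0 <= r by rewrite divr_ge0// ln_ge0// ler1n ltnW.
  apply: le_L2norm.
  - exact: ergodic_sum_bounded_measurable.
  - by rewrite !mulr_ge0 ?powR_ge0 ?sqrtr_ge0// ltW.
  apply: le_trans (integral_ergodic_sum_ge alpha01 irr bphi pphi eta0 eps m n).
  have th0 : 0 <= theta / 128 by rewrite divr_ge0// ltW.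
  rewrite powR12_sqrt// !exprMn !sqr_sqrtr//.
  have cnt : theta * m.-1%:R / 2 <=
      (\sum_(1 <= j < m) (res j && ~~ np j n))%:R :> R.
    have : (\sum_(1 <= j < m) res j <= \sum_(1 <= j < m) (res j && ~~ np j n) +
        \sum_(1 <= j < m) np j n)%N.
      by rewrite -big_split; apply: leq_sum => j _; case: (res j); case: (np j n).
    rewrite -(ler_nat R) natrD; have := dens m Mm.
    by move: good; lra.
  have mh : m%:R / 2 <= m.-1%:R :> R.
    have : m%:R = m.-1%:R + 1 :> R by rewrite natr1 prednK// ltnW.
    lra.
  apply: (@le_trans _ _ (eta ^+ 2 * eps ^+ 2 / 16 * (theta * m.-1%:R / 2))); last first.
    by apply: ler_wpM2l cnt; rewrite !mulr_ge0 ?invr_ge0// ltW.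
  have -> : eta ^+ 2 * (theta / 128) * r = eta ^+ 2 * theta / 128 * r by field.
  apply: (@le_trans _ _ (eta ^+ 2 * theta / 128 * (2 * (m%:R / ln m%:R)))).
    by rewrite ler_wpM2l// !mulr_ge0 ?sqr_ge0 ?invr_ge0 ?ltW.
  rewrite -eps2.
  have -> : eta ^+ 2 * theta / 128 * (2 * (m%:R * eps ^+ 2)) =
    eta ^+ 2 * theta * eps ^+ 2 / 32 * (m%:R / 2) by field.
  have -> : eta ^+ 2 * eps ^+ 2 / 16 * (theta * m.-1%:R / 2) =
    eta ^+ 2 * theta * eps ^+ 2 / 32 * m.-1%:R by field.
  by rewrite ler_wpM2l// !mulr_ge0 ?sqr_ge0 ?invr_ge0 ?ltW.
have m1 : m%:R / 2 <= m.-1%:R :> R.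
  by have : m%:R = m.-1%:R + 1 :> R; [rewrite natr1 prednK// ltnW | lra].
have meps1 : 1 <= m%:R * eps by rewrite mulrC -ler_pdivrMr// mul1r.
have badcount : (\sum_(0 <= n < N) bad n)%:R <= 88 / theta * eps * N%:R.
  have h : (\sum_(0 <= n < N) bad n)%:R * (theta * m.-1%:R / 2) <=
      \sum_(1 <= j < m) (20 * eps * N%:R + 3 * N%:R / (q j.+1)%:R).
    apply: markov_sum => j /andP[j0 jm]; apply: count_small_rotation => //.
    - exact: cf_distance_gt0.
    - by rewrite cf_denominator_gt0//= (leq_trans _ qmN)//; exact: cf_denominator_le.
    - exact: cf_distance_le.
    - exact: cf_distance_ge.
  move: h; rewrite big_split /= sumr_const_nat -big_distrr /= subn1.
  have : \sum_(1 <= j < m) (q j.+1)%:R^-1 <= 4 :> R.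
    apply: le_trans (sum_inv_cf_denominator alpha01 irr m.+1).
    have -> : \sum_(1 <= j < m) (q j.+1)%:R^-1 = \sum_(2 <= j < m.+1) (q j)%:R^-1 :> R.
      by rewrite [RHS]big_add1.
    rewrite [leRHS](@big_cat_nat _ _ _ 2)//= ?lerDr ?sumr_ge0// ltnW//.
  rewrite -[X in X + _]mulr_natr.
  set S := \sum_(1 <= j < m) _; set B := (\sum_(0 <= n < N) _)%:R => S4 h.
  (* The reciprocals contribute at most 12 N <= 24 eps N (m - 1), because m eps >= 1 and m <= 2 (m -
     1). Adding 20 gives 44, doubled by the threshold theta (m - 1) / 2. *)
  have {}h : B * theta * m.-1%:R <= 88 * eps * N%:R * m.-1%:R.
    have : 3 * N%:R * S <= 3 * N%:R * 4 by rewrite ler_wpM2l.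
    have : N%:R <= N%:R * (2 * m.-1%:R * eps) by rewrite ler_peMr//; nra.
    by lra.
  rewrite (_ : 88 / theta * eps * N%:R = 88 * eps * N%:R / theta); last by field; rewrite gt_eqF.
  by rewrite ler_pdivlMr//; rewrite ler_pM2r // in h; lra.
have q2 : (q 2)%:R <= (q 2)%:R * eps * N%:R.
  rewrite -mulrA ler_peMr//; apply: (le_trans meps1).
  by rewrite mulrC ler_pM2l// ler_nat (leq_trans _ qmN)// leq_cf_denominator.
(* Each n < N is in W, below q_2, or bad. *)
have count : (N <= #|` fset_set (W `&` [set n | (0 <= n < N)%N])| + q 2 +
    \sum_(0 <= n < N) bad n)%N.
  rewrite setIC card_fset_set_nat_itv.
  have q2N : (\sum_(0 <= n < N) (n < q 2) <= q 2)%N.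
    suff -> : (\sum_(0 <= n < N) (n < q 2) = minn N (q 2))%N by rewrite geq_minr.
    elim: {+}N => [|k IH]; first by rewrite big_nil min0n.
    by rewrite big_nat_recr//= IH; lia.
  rewrite -[leqLHS]subn0 -[leqLHS]muln1 -sum_nat_const_nat.
  apply: (@leq_trans (\sum_(0 <= n < N) (n \in W) + \sum_(0 <= n < N) (n < q 2) +
      \sum_(0 <= n < N) bad n)); last by rewrite leq_add2r leq_add2l.
  rewrite -!big_split /= !big_nat; apply: leq_sum => n /andP[_ nN].
  case: (ltnP n (q 2)) => [_|q2n]; first by rewrite addnAC addn1.
  by case: (boolP (bad n)) => [_|/(goodW n nN q2n)/mem_set->]; rewrite ?addn1.
rewrite ler_pdivlMr// /c; move: q2 count badcount; move: (q 2) => k.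
rewrite -(ler_nat R) !natrD => q2 count badcount.
have t0 : 0 <= 88 / theta by rewrite divr_ge0// ltW.
(* The excess of 2 c eps N over the two error terms. *)
have : 0 <= (88 / theta + k%:R + 2 * M%:R) * eps * N%:R.
  by rewrite !(mulr_ge0 _ (ler0n _ _), mulr_ge0 _ (ltW eps0))// !addr_ge0// mulr_ge0.
by lra.
Qed.
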